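(* Let $-1/2<\nu<1$. Let $f:\mathbb{R}^3\to[0,\infty)$ be a velocity distribution function, with associated density $\rho$, temperature $T$, collision frequency $A_\nu$, ellipsoidal Gaussian $\mathcal{M}_\nu(f)$ and local Maxwellian $\mathcal{M}_0=\mathcal{M}_0(f)$. Then the entropy production functional $D_\nu(f)=-\int_{\mathbb{R}^3}A_\nu\big(\mathcal{M}_\nu(f)-f\big)\ln f\,dv$ satisfies $$D_{\nu}(f)\ \geq\ \min\{1+2\nu,\,1-\nu\}\,A_{\nu}\,H(f|\mathcal{M}_{0}).$$
   Context: A velocity distribution function is a measurable $f:\mathbb{R}^3\to[0,\infty)$ with $\int (1+|v|^2) f\,dv<\infty$, $\int f\,dv>0$ and $f\ln f\in L^1(\mathbb{R}^3)$ (conventions $0\ln 0=0$, $\ln 0=-\infty$; $D_\nu(f)$ may take the value $+\infty$). In the kinetic setting $f=f(x,v,t)$ and $(x,t)$ is fixed. Its macroscopic quantities are $\rho=\int_{\mathbb{R}^3} f\,dv$, $\ \rho U=\int_{\mathbb{R}^3} f v\,dv$, $\ 3\rho T=\int_{\mathbb{R}^3} f|v-U|^2dv$, $\ \rho\Theta=\int_{\mathbb{R}^3} f\,(v-U)\otimes(v-U)\,dv$, where $\Theta$ is a symmetric $3\times3$ matrix. The temperature tensor is $\mathcal{T}_\nu=(1-\nu)T\,\mathrm{Id}+\nu\Theta$, and the ellipsoidal Gaussian is $$\mathcal{M}_\nu(f)(v)=\frac{\rho}{\sqrt{\det(2\pi\mathcal{T}_\nu)}}\exp\Big(-\tfrac12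 (v-U)^\top\mathcal{T}_\nu^{-1}(v-U)\Big).$$ In particular $\mathcal{M}_0(f)(v)=\rho(2\pi T)^{-3/2}\exp(-|v-U|^2/(2T))$. The collision frequency is $A_\nu=\rho^\alpha T^\beta/(1-\nu)$ for some fixed $\alpha,\beta\ge0$. The relative entropy is $H(f|g)=\int_{\mathbb{R}^3} f\ln(f/g)\,dv$. *)

(* Defs.v *)
From HB Require Import structures.
From mathcomp Require Import all_boot all_order all_algebra.
From mathcomp Require Import all_classical all_reals all_analysis.

Set Implicit Arguments.
Unset Strict Implicit.
Unset Printing Implicit Defensive.

Import Order.TTheory GRing.Theory Num.Theory.
Import numFieldNormedType.Exports.

Local Open Scope classical_set_scope.
Local Open Scope ring_scope.

Definition borel_lebesgue3 (R : realType) :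
    {measure
       set (measurableTypeR R * measurableTypeR R * measurableTypeR R)%type
       -> \bar R} :=
  ((@lebesgue_measure R \x @lebesgue_measure R) \x @lebesgue_measure R)%E.

(* The completion makes the measurable sets of [vspace3 R] the Lebesgue
   measurable sets; [borel_lebesgue3] only knows the Borel ones. *)
Definition lebesgue3 (R : realType) :=
  @completed_measure_extension _ _ _ (borel_lebesgue3 R).

Arguments lebesgue3 R : clear implicits.

HB.instance Definition _ (R : realType) := Measure.on (lebesgue3 R).

(* Convertible to R * R * R. *)
Notation vspace3 R :=
  (caratheodory_type (mu_ext (borel_lebesgue3 R))).

Definition vec3 (R : realType) (v : R * R * R) : 'cV[R]_3 :=
  \col_i [:: v.1.1; v.1.2; v.2]`_i.

(* Squared Euclidean norm; the library norm on matrices is the sup norm. *)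
Definition sqnorm3 (R : realType) (x : 'cV[R]_3) : R := \sum_i x i 0 ^+ 2.

Section Macroscopic.
Context {R : realType}.
Implicit Types (f g : vspace3 R -> R) (nu alpha beta : R).

Local Notation mu := (lebesgue3 R).

(* [lne 0 = -oo] and [0 * -oo = 0] in [\bar R]. *)
Record velocity_distribution f : Prop := VelocityDistribution {
  vd_ge0 : forall v, 0 <= f v ;
  vd_measurable : measurable_fun [set: vspace3 R] f ;
  vd_moments : (\int[mu]_v ((1 + sqnorm3 (vec3 v)) * f v)%:E < +oo)%E ;
  vd_mass : (0 < \int[mu]_v (f v)%:E)%E ;
  vd_entropy : mu.-integrable [set: vspace3 R]
    (fun v => (f v)%:E * lne (f v)%:E)%E
}.

Definition density f : R := \int[mu]_v f v.

Definition bulk_velocity f : 'cV[R]_3 :=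
  \col_i ((density f)^-1 * \int[mu]_v (f v * vec3 v i 0)).

Definition temperature f : R :=
  (3 * density f)^-1
  * \int[mu]_v (f v * sqnorm3 (vec3 v - bulk_velocity f)).

Definition stress_tensor f : 'M[R]_3 :=
  \matrix_(i, j) ((density f)^-1
    * \int[mu]_v (f v * ((vec3 v - bulk_velocity f)
                         *m (vec3 v - bulk_velocity f)^T) i j)).

Definition temperature_tensor nu f : 'M[R]_3 :=
  ((1 - nu) * temperature f)%:M + nu *: stress_tensor f.

Definition ellipsoidal_gaussian nu f : vspace3 R -> R := fun v =>
  let w := vec3 v - bulk_velocity f in
  density f / Num.sqrt (\det ((2 * pi) *: temperature_tensor nu f))
  * expR (- (1 / 2) * (w^T *m invmx (temperature_tensor nu f) *m w) 0 0).

Definition local_maxwellian f := ellipsoidal_gaussian 0 f.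

Definition collision_frequency alpha beta nu f : R :=
  density f `^ alpha * temperature f `^ beta / (1 - nu).

Definition relative_entropy f g : \bar R :=
  (\int[mu]_v ((f v)%:E * lne (f v / g v)%:E))%E.

Definition entropy_production alpha beta nu f : \bar R :=
  (- \int[mu]_v ((collision_frequency alpha beta nu f
                  * (ellipsoidal_gaussian nu f v - f v))%:E
                 * lne (f v)%:E))%E.

End Macroscopic.

(* Main.v *)
From HB Require Import structures.
Require Import Defs.
From mathcomp Require Import all_boot all_order all_algebra.
From mathcomp Require Import all_classical all_reals all_analysis.
From mathcomp Require Import measurable_realfun ring lra.

Set Implicit Arguments.
Unset Strict Implicit.
Unset Printing Implicit Defensive.

Import Order.TTheory GRing.Theory Num.Theory.
Import numFieldNormedType.Exports.

Local Open Scope classical_set_scope.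
Local Open Scope ring_scope.

(** The estimate is a comparison of three Gaussians.

    Write [A] for the collision frequency, [S] for the integral of [f ln f],
    [B] for the temperature tensor, and [c] for the minimum of [1 + 2 nu] and
    [1 - nu].  Each of the covariances [B], [T Id] and [Theta] has a Gaussian
    with the mass and the mean of [f]; its entropy is
    [rho (ln rho - ln det (2 pi Q) / 2) - 3 rho / 2] for the covariance [Q].

    Convexity of [x ln x] gives pointwise
    [(f - M) ln f >= f ln f - M ln M + M - f], so the entropy production is at
    least [A] times the entropy of [f] minus that of [M], the Gaussian of
    covariance [B] ([entropy_production_ge]).  The relative entropy to the
    Maxwellian is the entropy of [f] minus that of the Gaussian of covariance
    [T Id], because both have the same energy ([relative_entropyE]).  Among
    all densities with the moments of [f], the Gaussian of covariance [Theta]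
    has the least entropy ([entropy_ge]).  What remains after these three
    facts is the determinant inequality
    [c ln det (T Id) + (1 - c) ln det Theta <= ln det B]
    ([ln_det_tensor_ge]).

    For [nu >= 0] the tensor [B] is the convex combination of [T Id] and
    [Theta] with weights [c] and [1 - c], and the inequality is the concavity
    of [ln det] along the segment from a scalar matrix.  For [nu < 0] the same
    convex combination holds with [Theta] replaced by
    [C = (tr Theta Id - Theta) / 2]; in an eigenbasis of [Theta] the
    eigenvalues of [C] are the half sums of pairs of eigenvalues of [Theta],
    so that [det C >= det Theta].  Both steps are carried out without
    diagonalising: the coefficients of the characteristic polynomial satisfy
    the inequalities of Maclaurin between elementary symmetric functions
    ([posdef3_maclaurin]).

    On the analytic side, the mass of a Gaussian comes from completing the
    squares one coordinate at a time ([posdef3_inv_squares]), so that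
    iterated integration meets translated one-dimensional Gaussians only
    ([integral_gaussian]); its second moment comes from comparing it with its
    own rescalings ([gaussian_qform_ge]).  The tensor [Theta] is positive
    definite since [f] cannot be carried by a plane, which is negligible
    ([posdef_stress_tensor]). *)

(** * Positive definite matrices *)

Section PosDef.
Context (R : realType).

Definition qform n (Q : 'M[R]_n) (w : 'cV[R]_n) : R := (w^T *m Q *m w) 0 0.

Definition posdef n (Q : 'M[R]_n) : Prop :=
  Q^T = Q /\ forall w, w != 0 -> 0 < qform Q w.

Lemma qformD n (P Q : 'M[R]_n) w : qform (P + Q) w = qform P w + qform Q w.
Proof. by rewrite /qform mulmxDr mulmxDl mxE. Qed.

Lemma qformZ n (a : R) (Q : 'M[R]_n) w : qform (a *: Q) w = a * qform Q w.
Proof. by rewrite /qform -scalemxAr -scalemxAl mxE. Qed.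

Lemma qform_id n (w : 'cV[R]_n) : qform 1%:M w = \sum_i w i 0 ^+ 2.
Proof.
by rewrite /qform mulmx1 mxE; apply: eq_bigr => i _; rewrite mxE expr2.
Qed.

Lemma posdefZ n (a : R) (Q : 'M[R]_n) : 0 < a -> posdef Q -> posdef (a *: Q).
Proof.
move=> a0 [sQ pQ]; split=> [|w w0]; first by rewrite linearZ /= sQ.
by rewrite qformZ mulr_gt0 ?pQ.
Qed.

Lemma posdefD n (P Q : 'M[R]_n) : posdef P -> posdef Q -> posdef (P + Q).
Proof.
move=> [sP pP] [sQ pQ]; split=> [|w w0]; first by rewrite linearD /= sP sQ.
by rewrite qformD addr_gt0 ?pP ?pQ.
Qed.

Lemma posdef_id n : posdef (1%:M : 'M[R]_n).
Proof.
split=> [|w w0]; first by rewrite trmx1.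
rewrite qform_id lt_neqAle sumr_ge0 ?andbT => [|i _]; last exact: sqr_ge0.
apply: contra w0 => /eqP/esym/psumr_eq0P w2.
apply/eqP/colP => i; rewrite mxE; apply/eqP.
by rewrite -sqrf_eq0 w2// => j _; exact: sqr_ge0.
Qed.

Lemma posdef_unit n (Q : 'M[R]_n) : posdef Q -> Q \in unitmx.
Proof.
move=> [sQ pQ]; rewrite -row_free_unit -kermx_eq0; apply/eqP/row_matrixP => i.
rewrite row0; apply/eqP; apply: contraT => u0.
have /pQ : (row i (kermx Q))^T != 0 by rewrite trmx_eq0.
by rewrite /qform trmxK -row_mul mulmx_ker row0 mul0mx mxE ltxx.
Qed.

Lemma posdef_scalar n (a : R) : 0 < a -> posdef (a%:M : 'M[R]_n).
Proof. by move=> a0; rewrite -scalemx1; exact/posdefZ/posdef_id. Qed.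

End PosDef.

(** * Order three: minors, determinants and completed squares *)

Section Dim3.
Context (R : realType).
Implicit Types (Q : 'M[R]_3) (w : 'cV[R]_3).

Lemma sum3E (V : nmodType) (F : 'I_3 -> V) : \sum_i F i = F 0 + F 1 + F 2.
Proof.
rewrite !big_ord_recl big_ord0 addr0 addrA.
by congr (_ + F _ + F _); exact: val_inj.
Qed.

Definition minor2 Q (i j : 'I_3) : R := Q i i * Q j j - Q i j * Q j i.

Lemma det3E Q : \det Q =
  Q 0 0 * (Q 1 1 * Q 2 2 - Q 1 2 * Q 2 1)
  - Q 0 1 * (Q 1 0 * Q 2 2 - Q 1 2 * Q 2 0)
  + Q 0 2 * (Q 1 0 * Q 2 1 - Q 1 1 * Q 2 0).
Proof.
rewrite (expand_det_row _ 0) sum3E /cofactor.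
rewrite !(expand_det_row _ (0 : 'I_2)) !big_ord_recl !big_ord0 /cofactor.
rewrite !det_mx11 !mxE /=.
pose q (i j : nat) := Q (inord i) (inord j).
have qE i j : Q i j = q i j by rewrite /q !inord_val.
rewrite !qE /= /bump /= !addnE /=; ring.
Qed.

Lemma qform3E Q w : qform Q w =
  Q 0 0 * w 0 0 ^+ 2 + Q 1 1 * w 1 0 ^+ 2 + Q 2 2 * w 2 0 ^+ 2
  + (Q 0 1 + Q 1 0) * (w 0 0 * w 1 0) + (Q 0 2 + Q 2 0) * (w 0 0 * w 2 0)
  + (Q 1 2 + Q 2 1) * (w 1 0 * w 2 0).
Proof. by rewrite /qform mxE sum3E !mxE !sum3E !mxE; ring. Qed.

Lemma col3_neq0 w : w != 0 -> [|| w 0 0 != 0, w 1 0 != 0 | w 2 0 != 0].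
Proof.
apply: contraR; rewrite !negb_or !negbK => /and3P[/eqP w0 /eqP w1 /eqP w2].
apply/eqP/colP => i; rewrite mxE.
by case: i => -[|[|[|//]]] lti;
  [rewrite -[RHS]w0|rewrite -[RHS]w1|rewrite -[RHS]w2];
  congr (w _ _); exact: val_inj.
Qed.

Definition vector3 (x y z : R) : 'cV[R]_3 := \col_i [:: x; y; z]`_i.

Lemma vector3_neq0 x y z : [|| x != 0, y != 0 | z != 0] -> vector3 x y z != 0.
Proof.
apply: contraTneq => /colP e; rewrite negb_or negb_or !negbK.
by have := e 0; have := e 1; have := e 2; rewrite !mxE /= => -> -> ->; rewrite eqxx.
Qed.

Lemma posdef3_sym Q : posdef Q -> [/\ Q 1 0 = Q 0 1, Q 2 0 = Q 0 2 & Q 2 1 = Q 1 2].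
Proof. by move=> [sQ _]; split; rewrite -{1}sQ mxE. Qed.

Lemma posdef3_qform_gt0 Q x y z : posdef Q -> [|| x != 0, y != 0 | z != 0] ->
  0 < Q 0 0 * x ^+ 2 + Q 1 1 * y ^+ 2 + Q 2 2 * z ^+ 2
  + 2 * Q 0 1 * (x * y) + 2 * Q 0 2 * (x * z) + 2 * Q 1 2 * (y * z).
Proof.
move=> pQ xyz; have [s10 s20 s21] := posdef3_sym pQ.
have := pQ.2 _ (vector3_neq0 xyz); rewrite qform3E s10 s20 s21 !mxE /=.
set a := (X in 0 < X) => a0; set b := (X in 0 < X).
by have -> : b = a by rewrite /a /b; ring.
Qed.

(** Tested on the vector [Q i i e_j - Q i j e_i], the quadratic form takes the
    value [Q i i * minor2 Q i j]. *)
Lemma posdef3_minors Q : posdef Q ->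
  [/\ 0 < Q 0 0, 0 < Q 1 1 & 0 < Q 2 2] /\
  [/\ 0 < minor2 Q 0 1, 0 < minor2 Q 0 2 & 0 < minor2 Q 1 2].
Proof.
move=> pQ; have [s10 s20 s21] := posdef3_sym pQ.
have P x y z := @posdef3_qform_gt0 Q x y z pQ.
have q0 : 0 < Q 0 0.
  by have := P 1 0 0; rewrite oner_eq0 => /(_ isT); nra.
have q1 : 0 < Q 1 1.
  by have := P 0 1 0; rewrite oner_eq0 orbT => /(_ isT); nra.
have q2 : 0 < Q 2 2.
  by have := P 0 0 1; rewrite oner_eq0 !orbT => /(_ isT); nra.
split=> //; rewrite /minor2 s10 s20 s21; split.
- rewrite -(pmulr_rgt0 _ q0).
  have := P (- Q 0 1) (Q 0 0) 0; rewrite (gt_eqF q0) orbT => /(_ isT).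
  by congr (_ < _); ring.
- rewrite -(pmulr_rgt0 _ q0).
  have := P (- Q 0 2) 0 (Q 0 0); rewrite (gt_eqF q0) !orbT => /(_ isT).
  by congr (_ < _); ring.
- rewrite -(pmulr_rgt0 _ q1).
  have := P 0 (- Q 1 2) (Q 1 1); rewrite (gt_eqF q1) !orbT => /(_ isT).
  by congr (_ < _); ring.
Qed.

(** The last row of cofactors [x] satisfies [Q x = det Q e_3], hence
    [x^T Q x = det Q * minor2 Q 0 1]. *)
Lemma posdef3_det_gt0 Q : posdef Q -> 0 < \det Q.
Proof.
move=> pQ; have [s10 s20 s21] := posdef3_sym pQ.
have [_ [m01 _ _]] := posdef3_minors pQ; rewrite /minor2 s10 in m01.
have P x y z := @posdef3_qform_gt0 Q x y z pQ.
rewrite -(pmulr_rgt0 _ m01).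
have := P (Q 0 1 * Q 1 2 - Q 0 2 * Q 1 1) (Q 0 1 * Q 0 2 - Q 0 0 * Q 1 2)
  (Q 0 0 * Q 1 1 - Q 0 1 * Q 0 1).
rewrite (gt_eqF m01) !orbT => /(_ isT).
by congr (_ < _); rewrite det3E s10 s20 s21; ring.
Qed.

(** Completing the squares in the inverse form.  The square number [i]
    involves the coordinates up to [i] only, and its leading coefficient is
    [1]: for a Gaussian vector of covariance [Q], the three squares are the
    first coordinate and the deviations of the second and the third from
    their regression on the earlier ones, and the [d] are the conditional
    variances. *)
Lemma posdef3_inv_squares Q : posdef Q -> exists d : R * R * R, exists a b c : R,
  [/\ 0 < d.1.1, 0 < d.1.2, 0 < d.2, \det Q = d.1.1 * d.1.2 * d.2 &
   forall w, qform (invmx Q) w = w 0 0 ^+ 2 / d.1.1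
     + (w 1 0 - a * w 0 0) ^+ 2 / d.1.2
     + (w 2 0 - (b * w 0 0 + c * w 1 0)) ^+ 2 / d.2].
Proof.
move=> pQ; have [s10 s20 s21] := posdef3_sym pQ.
have [[q0 _ _] [m01 _ _]] := posdef3_minors pQ.
have d0 := posdef3_det_gt0 pQ.
exists (Q 0 0, minor2 Q 0 1 / Q 0 0, \det Q / minor2 Q 0 1), (Q 0 1 / Q 0 0).
exists ((Q 0 2 * Q 1 1 - Q 0 1 * Q 1 2) / minor2 Q 0 1).
exists ((Q 0 0 * Q 1 2 - Q 0 1 * Q 0 2) / minor2 Q 0 1) => /=.
split=> [//||||w]; try by rewrite divr_gt0.
  by rewrite [X in X * _]mulrC divfK ?gt_eqF// mulrC divfK ?gt_eqF.
(* In the coordinates of [x] both sides are rational in the entries of [Q]. *)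
pose x := invmx Q *m w.
have wE : w = Q *m x by rewrite mulKVmx// posdef_unit.
have -> : qform (invmx Q) w = qform Q x.
  rewrite {1}/qform -mulmxA -/x {1}wE trmx_mul pQ.1 /qform; congr fun_of_matrix.
clearbody x; rewrite {}wE qform3E !mxE !sum3E s10 s20 s21.
have n0 := gt_eqF q0; have nm := gt_eqF m01; have nd := gt_eqF d0.
rewrite /minor2 s10 in nm *; rewrite det3E s10 s20 s21 in nd *.
by field; rewrite n0 nm nd.
Qed.

Lemma det3_shift Q s t : \det (s%:M + t *: Q) =
  s ^+ 3 + s ^+ 2 * t * \tr Q
  + s * t ^+ 2 * (minor2 Q 0 1 + minor2 Q 0 2 + minor2 Q 1 2) + t ^+ 3 * \det Q.
Proof. by rewrite !det3E /mxtrace sum3E /minor2 !mxE /=; ring. Qed.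

Lemma ln_le_sub1 (x : R) : 0 < x -> ln x <= x - 1.
Proof.
by move=> x0; rewrite -[in leLHS](subrKC 1 x) le_ln1Dx// ltrBrDr addNr.
Qed.

Lemma amgm3 (a b c g : R) : 0 < a -> 0 < b -> 0 < c -> 0 < g ->
  g ^+ 3 <= a * b * c -> 3 * g <= a + b + c.
Proof.
move=> a0 b0 c0 g0 abc; rewrite leNgt; apply/negP => lt.
(* The difference is a positive combination of [a (b - c)^2] and its
   permutations, and of [a^3 + b^3 + c^3 - 3 a b c]. *)
have h27 : 27 * (a * b * c) <= (a + b + c) ^+ 3.
  have : 0 <= a * (b - c) ^+ 2 by rewrite mulr_ge0 ?sqr_ge0// ltW.
  have : 0 <= b * (a - c) ^+ 2 by rewrite mulr_ge0 ?sqr_ge0// ltW.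
  have : 0 <= c * (a - b) ^+ 2 by rewrite mulr_ge0 ?sqr_ge0// ltW.
  have : 0 <= (a + b + c) * ((a - b) ^+ 2 + (b - c) ^+ 2 + (a - c) ^+ 2).
    by rewrite mulr_ge0 ?addr_ge0 ?sqr_ge0// ltW.
  lra.
have : (a + b + c) ^+ 3 < (3 * g) ^+ 3.
  by rewrite ltrXn2r// ?addr_ge0 ?mulr_ge0// ltW.
have -> : (3 * g) ^+ 3 = 27 * g ^+ 3 by ring.
lra.
Qed.

(** Fischer's inequality for the symmetric matrix with diagonal [a, b, c] and
    off-diagonal entries [p, q, r], split as [1 + 2]. *)
Lemma det3_le_minor2 (a b c p q r : R) : 0 < c -> 0 < b * c - r ^+ 2 ->
  a * (b * c - r ^+ 2) - p * (p * c - r * q) + q * (p * r - b * q)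
  <= a * (b * c - r ^+ 2).
Proof.
move=> c0 m0; rewrite -subr_ge0 -(pmulr_rge0 _ c0).
have -> : c * (a * (b * c - r ^+ 2) - (a * (b * c - r ^+ 2)
    - p * (p * c - r * q) + q * (p * r - b * q)))
  = (p * c - q * r) ^+ 2 + q ^+ 2 * (b * c - r ^+ 2) by ring.
by rewrite addr_ge0 ?sqr_ge0// mulr_ge0 ?sqr_ge0// ltW.
Qed.

(** Hadamard's inequality for [Q] and for its adjugate; the latter has the
    principal minors on its diagonal and determinant [det Q ^ 2]. *)
Lemma posdef3_hadamard Q : posdef Q ->
  \det Q <= Q 0 0 * Q 1 1 * Q 2 2 /\
  \det Q ^+ 2 <= minor2 Q 0 1 * minor2 Q 0 2 * minor2 Q 1 2.
Proof.
move=> pQ; have [s10 s20 s21] := posdef3_sym pQ.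
have [[q0 q1 q2] [m01 m02 m12]] := posdef3_minors pQ; have d0 := posdef3_det_gt0 pQ.
have h0 : \det Q <= Q 0 0 * minor2 Q 1 2.
  have := @det3_le_minor2 (Q 0 0) (Q 1 1) (Q 2 2) (Q 0 1) (Q 0 2) (Q 1 2) q2.
  move: m12; rewrite det3E /minor2 s10 s20 s21 -!expr2 => m /(_ m).
  by rewrite expr2.
have h2 : \det Q <= Q 2 2 * minor2 Q 0 1.
  have := @det3_le_minor2 (Q 2 2) (Q 0 0) (Q 1 1) (Q 0 2) (Q 1 2) (Q 0 1) q1.
  move: m01; rewrite det3E /minor2 s10 s20 s21 -!expr2 => m /(_ m).
  by apply: le_trans; rewrite le_eqVlt; apply/orP; left; apply/eqP; ring.
(* Sylvester's identity: the difference of the two sides is a square. *)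
have hs : Q 2 2 * \det Q <= minor2 Q 0 2 * minor2 Q 1 2.
  rewrite -subr_ge0 det3E /minor2 s10 s20 s21.
  have := sqr_ge0 (Q 0 1 * Q 2 2 - Q 0 2 * Q 1 2).
  by congr (_ <= _); ring.
split.
  rewrite (le_trans h0)// -mulrA ler_pM2l// /minor2 s21 lerBlDr lerDl.
  by rewrite -expr2 sqr_ge0.
rewrite expr2 -mulrA (le_trans (ler_wpM2r (ltW d0) h2))// mulrAC mulrC.
by rewrite ler_pM2l// mulrC.
Qed.

(** Maclaurin's inequalities for the eigenvalues, [g] being their geometric
    mean.  Traces and sums of principal minors dominate the symmetric means of
    diagonal entries and minors, so that Hadamard's inequality reduces them to
    the arithmetic-geometric mean inequality for three numbers. *)
Lemma posdef3_maclaurin Q : posdef Q -> exists g : R,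
  [/\ 0 < g, g ^+ 3 = \det Q, 3 * g <= \tr Q
    & 3 * g ^+ 2 <= minor2 Q 0 1 + minor2 Q 0 2 + minor2 Q 1 2].
Proof.
move=> pQ; have d0 := posdef3_det_gt0 pQ.
have [[q0 q1 q2] [m01 m02 m12]] := posdef3_minors pQ.
have [hd hd2] := posdef3_hadamard pQ.
pose g := expR (ln (\det Q) / 3); have g0 : 0 < g := expR_gt0 _.
have gE : g ^+ 3 = \det Q.
  by rewrite /g -expRM_natr divfK ?lnK// posrE.
have e1 : 3 * g <= \tr Q.
  by rewrite /mxtrace sum3E; apply: amgm3; rewrite // gE.
have e2 : 3 * g ^+ 2 <= minor2 Q 0 1 + minor2 Q 0 2 + minor2 Q 1 2.
  by apply: amgm3; rewrite ?exprn_gt0// exprAC gE.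
by exists g.
Qed.

(** Concavity of [ln det] on the segment from a scalar matrix to [Q].  The
    determinant of [s Id + w Q] is a cubic in [s] and [w] whose coefficients
    are the symmetric functions of the eigenvalues; by Maclaurin it is at
    least [(s + w g)^3], and the arithmetic mean [s + w g] is at least the
    geometric one. *)
Lemma ln_det3_concave Q (t c : R) : posdef Q -> 0 < t -> 0 <= c <= 1 ->
  c * ln (t ^+ 3) + (1 - c) * ln (\det Q) <=
  ln (\det ((c * t)%:M + (1 - c) *: Q)).
Proof.
move=> pQ t0 /andP[c0 c1]; have d0 := posdef3_det_gt0 pQ.
have [g [g0 gE e1 e2]] := posdef3_maclaurin pQ.
pose m := c * t + (1 - c) * g.
have m0 : 0 < m.
  rewrite /m; move: c0; rewrite le_eqVlt => /predU1P[<-|c0'].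
    by rewrite mul0r add0r subr0 mul1r.
  by rewrite ltr_pwDl ?mulr_gt0 ?mulr_ge0 ?subr_ge0// ltW.
have det_ge : m ^+ 3 <= \det ((c * t)%:M + (1 - c) *: Q).
  rewrite det3_shift -gE.
  have -> : m ^+ 3 = (c * t) ^+ 3 + (c * t) ^+ 2 * (1 - c) * (3 * g)
    + (c * t) * (1 - c) ^+ 2 * (3 * g ^+ 2) + (1 - c) ^+ 3 * g ^+ 3.
    by rewrite /m; ring.
  have ct0 : 0 <= c * t by rewrite mulr_ge0// ltW.
  rewrite !lerD//; apply: ler_wpM2l => //; apply: mulr_ge0 => //;
    by rewrite ?exprn_ge0 ?subr_ge0.
have {det_ge} : ln (m ^+ 3) <= ln (\det ((c * t)%:M + (1 - c) *: Q)).
  by rewrite ler_ln// posrE ?exprn_gt0// (lt_le_trans _ det_ge)// exprn_gt0.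
apply: le_trans.
rewrite -gE !lnXn//.
(* Weighted arithmetic-geometric mean: tangent line of [ln] at [m]. *)
have := ln_le_sub1 (divr_gt0 t0 m0); have := ln_le_sub1 (divr_gt0 g0 m0).
rewrite !ln_div ?posrE// => hg ht.
have : c * (ln t - ln m) + (1 - c) * (ln g - ln m) <=
   c * (t / m - 1) + (1 - c) * (g / m - 1).
  by rewrite lerD// ler_wpM2l// subr_ge0.
have -> : c * (t / m - 1) + (1 - c) * (g / m - 1) = 0.
  have -> : c * (t / m - 1) + (1 - c) * (g / m - 1) =
      (c * t + (1 - c) * g) / m - 1 by ring.
  by rewrite -/m divff ?subrr// gt_eqF.
rewrite -[ln t *+ 3]mulr_natr -[ln g *+ 3]mulr_natr -[ln m *+ 3]mulr_natr; lra.
Qed.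

(** Its eigenvalues are the half sums of the pairs of eigenvalues of [Q]. *)
Definition complementary_tensor Q : 'M[R]_3 := (\tr Q / 2)%:M - 2^-1 *: Q.

Lemma posdef_complementary_tensor Q : posdef Q -> posdef (complementary_tensor Q).
Proof.
move=> pQ; have [s10 s20 s21] := posdef3_sym pQ.
split; first by rewrite /complementary_tensor linearB /= tr_scalar_mx linearZ /= pQ.1.
move=> w w0; rewrite -(pmulr_rgt0 _ (ltr0n R 2)).
pose F x y z := Q 0 0 * x ^+ 2 + Q 1 1 * y ^+ 2 + Q 2 2 * z ^+ 2
  + 2 * Q 0 1 * (x * y) + 2 * Q 0 2 * (x * z) + 2 * Q 1 2 * (y * z).
(* Lagrange's identity: [F] is evaluated at the three vectors
   [w_i e_j - w_j e_i] for [i < j]. *)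
have -> : 2 * qform (complementary_tensor Q) w =
    F (- w 1 0) (w 0 0) 0 + F (- w 2 0) 0 (w 0 0) + F 0 (- w 2 0) (w 1 0).
  rewrite qform3E /F /complementary_tensor !mxE /mxtrace sum3E s10 s20 s21 /=.
  by field.
have F0 x y z : [|| x != 0, y != 0 | z != 0] -> 0 < F x y z.
  exact: posdef3_qform_gt0.
have F_ge0 x y z : 0 <= F x y z.
  have [/F0/ltW//|] := boolP [|| x != 0, y != 0 | z != 0].
  rewrite !negb_or !negbK => /and3P[/eqP-> /eqP-> /eqP->].
  by rewrite /F !expr0n /= !mulr0 !addr0.
case/or3P: (col3_neq0 w0) => wi.
- by apply: ltr_wpDr => //; apply: ltr_wpDr => //; rewrite F0// wi orbT.
- by apply: ltr_wpDr => //; apply: ltr_wpDr => //; rewrite F0// oppr_eq0 wi.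
- by apply: ltr_wpDr => //; apply: ltr_wpDl => //; rewrite F0// oppr_eq0 wi.
Qed.

(** With [e1, e2, e3] the symmetric functions of the eigenvalues of [Q], the
    determinant of the complementary tensor is [(e1 e2 - e3) / 8], while
    [e1 e2 >= 9 e3] by Maclaurin. *)
Lemma det_complementary_tensor_ge Q : posdef Q ->
  \det Q <= \det (complementary_tensor Q).
Proof.
move=> pQ; have [g [g0 gE e1 e2]] := posdef3_maclaurin pQ.
rewrite /complementary_tensor -scaleNr det3_shift -gE.
set e := minor2 Q 0 1 + _ + _ in e2 *.
have -> : (\tr Q / 2) ^+ 3 + (\tr Q / 2) ^+ 2 * - 2^-1 * \tr Q +
  \tr Q / 2 * (- 2^-1) ^+ 2 * e + (- 2^-1) ^+ 3 * g ^+ 3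
  = (\tr Q * e - g ^+ 3) / 8 by field.
have : (3 * g) * (3 * g ^+ 2) <= \tr Q * e.
  by rewrite ler_pM// mulr_ge0// ?exprn_ge0// ltW.
have -> : (3 * g) * (3 * g ^+ 2) = 9 * g ^+ 3 by ring.
lra.
Qed.

(** The determinant inequality behind the constant [c].  For negative [nu] the
    matrix [Q] enters the tensor with a negative weight; its complementary
    tensor, which also has trace [3 t], enters with weight [- 2 nu], which
    leaves [1 + 2 nu] for [t Id] and makes the combination convex. *)
Lemma ln_det_tensor_ge Q (nu t : R) : posdef Q -> \tr Q = 3 * t ->
  - (1 / 2) < nu -> nu < 1 ->
  posdef (((1 - nu) * t)%:M + nu *: Q) /\
  let c := Num.min (1 + 2 * nu) (1 - nu) in
  c * ln (\det (t%:M : 'M[R]_3)) + (1 - c) * ln (\det Q) <=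
  ln (\det (((1 - nu) * t)%:M + nu *: Q)).
Proof.
move=> pQ trQ nu_gt nu_lt.
have t0 : 0 < t.
  have [[q0 q1 q2] _] := posdef3_minors pQ.
  by move: trQ; rewrite /mxtrace sum3E; lra.
rewrite det_scalar.
have [nu0|nu0] := leP 0 nu.
  split; last first.
    have -> /= : Num.min (1 + 2 * nu) (1 - nu) = 1 - nu by rewrite min_r//; lra.
    have /= := @ln_det3_concave Q t (1 - nu) pQ t0.
    by rewrite opprB addrCA subrr addr0; apply; lra.
  move: nu0; rewrite le_eqVlt => /predU1P[<-|nu0].
    by rewrite subr0 mul1r scale0r addr0; exact: posdef_scalar.
  apply: posdefD; last exact: posdefZ.
  by apply: posdef_scalar; rewrite mulr_gt0// subr_gt0.
have pC := posdef_complementary_tensor pQ.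
have -> : ((1 - nu) * t)%:M + nu *: Q =
    ((1 + 2 * nu) * t)%:M + (1 - (1 + 2 * nu)) *: complementary_tensor Q.
  apply/matrixP => i j; rewrite !mxE trQ.
  by case: (i == j); rewrite /= ?mulr1n ?mulr0n; field.
split.
  apply: posdefD; last by apply: posdefZ => //; lra.
  by apply: posdef_scalar; rewrite mulr_gt0//; lra.
have -> /= : Num.min (1 + 2 * nu) (1 - nu) = 1 + 2 * nu by rewrite min_l//; lra.
apply: le_trans (ln_det3_concave pC t0 _); last by apply/andP; split; lra.
rewrite lerD2l ler_wpM2l//; first lra.
by rewrite ler_ln ?posrE ?posdef3_det_gt0// det_complementary_tensor_ge.
Qed.

End Dim3.

(** * Lebesgue measure on the velocity space *)

Section Lebesgue3.
Context (R : realType).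

Local Notation borel3 :=
  (measurableTypeR R * measurableTypeR R * measurableTypeR R)%type.
Local Notation leb3 :=
  ((@lebesgue_measure R \x @lebesgue_measure R) \x @lebesgue_measure R)%E.
Local Notation mu := (lebesgue3 R).

Lemma borel_lebesgue_measurable (A : set borel3) :
  measurable A -> measurable (A : set (vspace3 R)).
Proof. by move=> mA; apply: sub_caratheodory; exact: sub_sigma_algebra. Qed.

(** The completed measure extends the product measure on Borel sets, so that
    the integral of a Borel function can be computed by iterated integration. *)
Lemma lebesgue3E (A : set borel3) :
  measurable A -> (mu A = leb3 A)%E.
Proof. exact: measurable_mu_extE. Qed.

Lemma measurable_borel_lebesgue (d : measure_display) (T : measurableType d)
    (g : borel3 -> T) :
  measurable_fun [set: borel3] g ->
  measurable_fun [set: vspace3 R] (g : vspace3 R -> T).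
Proof.
move=> mg _ B mB; rewrite setTI; apply: borel_lebesgue_measurable.
by rewrite -[X in measurable X]setTI; exact: mg.
Qed.

Lemma ge0_integral_lebesgue3 (g : borel3 -> \bar R) :
  measurable_fun [set: borel3] g -> (forall v, 0 <= g v)%E ->
  (\int[mu]_v g v = \int[leb3]_v g v)%E.
Proof.
move=> mg g0.
have mid : measurable_fun [set: vspace3 R] (idfun : vspace3 R -> borel3).
  by apply: measurable_borel_lebesgue; exact: measurable_id.
rewrite (@eq_measure_integral _ _ _ setT (pushforward mu (idfun : vspace3 R -> borel3))).
  by rewrite ge0_integral_pushforward.
by move=> A mA _; rewrite /= /pushforward lebesgue3E.
Qed.

Lemma measurable_coord (i : 'I_3) :
  measurable_fun [set: vspace3 R] (fun v : vspace3 R => vec3 v i 0).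
Proof.
apply: (@measurable_borel_lebesgue _ _ (fun v => vec3 v i 0)).
case: i => -[|[|[|//]]] lti; rewrite /vec3.
- rewrite (_ : (fun _ => _) = fst \o fst); last by apply/funext => v; rewrite mxE.
  exact: (measurableT_comp measurable_fst measurable_fst).
- rewrite (_ : (fun _ => _) = snd \o fst); last by apply/funext => v; rewrite mxE.
  exact: (measurableT_comp measurable_snd measurable_fst).
- rewrite (_ : (fun _ => _) = snd); last by apply/funext => v; rewrite mxE.
  exact: measurable_snd.
Qed.

(** Every vertical section of a graph is a point. *)
Lemma lebesgue_graph0 (d : measure_display) (T : measurableType d)
  (m : {measure set T -> \bar R}) (h : T -> R) :
  (m \x (@lebesgue_measure R))%E [set v | v.2 = h v.1] = 0%E.
Proof.
rewrite /product_measure1 integral0_eq// => x _ /=.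
rewrite (_ : xsection _ _ = [set h x]) ?lebesgue_measure_set1//.
by apply/seteqP; split => y; rewrite /xsection /= inE.
Qed.

(** At the last coordinate where the normal vector does not vanish, the plane
    is the graph of an affine function of the earlier coordinates; the later
    ones are free. *)
Lemma lebesgue3_plane0 (u : 'cV[R]_3) (k : R) : u != 0 ->
  mu [set v | \sum_i u i 0 * vec3 v i 0 = k] = 0%E.
Proof.
move=> u0; set P := [set v | _].
have mP : measurable (P : set borel3).
  pose g (v : borel3) := u 0 0 * v.1.1 + u 1 0 * v.1.2 + u 2 0 * v.2.
  have mg : measurable_fun [set: borel3] g.
    apply: measurable_funD; last first.
      by apply: measurable_funM => //; exact: measurable_snd.
    apply: measurable_funD; apply: measurable_funM => //.
      exact: (measurableT_comp measurable_fst measurable_fst).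
    exact: (measurableT_comp measurable_snd measurable_fst).
  have -> : P = g @^-1` [set k].
    by apply/seteqP; split => v; rewrite /P /g /= sum3E !mxE.
  by rewrite -[X in measurable X]setTI; exact: mg.
rewrite lebesgue3E//.
have [u20|u20] := eqVneq (u 2 0) 0; last first.
  rewrite (_ : P = [set v | v.2 = (k - u 0 0 * v.1.1 - u 1 0 * v.1.2) / u 2 0]).
    exact: (lebesgue_graph0 _
      (fun x : measurableTypeR R * measurableTypeR R =>
        (k - u 0 0 * x.1 - u 1 0 * x.2) / u 2 0)).
  apply/seteqP; split => v; rewrite /P /= sum3E !mxE /=.
    by move=> <-; field.
  by move=> ->; field.
have [u10|u10] := eqVneq (u 1 0) 0; last first.
  pose h (x : measurableTypeR R) : R := (k - u 0 0 * x) / u 1 0.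
  pose A : set (measurableTypeR R * measurableTypeR R) := [set x | x.2 = h x.1].
  have mA : measurable A.
    have -> : A = (fun x => x.2 - h x.1) @^-1` [set 0].
      apply/seteqP; split => x; rewrite /A /= => /eqP.
        by rewrite -subr_eq0 => /eqP.
      by rewrite subr_eq0 => /eqP.
    rewrite -[X in measurable X]setTI.
    suff mh : measurable_fun [set: measurableTypeR R * measurableTypeR R]
      (fun x : measurableTypeR R * measurableTypeR R => x.2 - h x.1) by exact: mh.
    apply: measurable_funB; first exact: measurable_snd.
    apply: (measurableT_comp _ measurable_fst).
    apply: measurable_funM => //; apply: measurable_funB => //.
  have -> : P = A `*` setT.
    apply/seteqP; split => v; rewrite /P /A /h /= sum3E !mxE u20 mul0r addr0 /=.
      by move=> <-; split => //; field.
    by move=> [-> _]; field.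
  rewrite product_measure1E//.
  rewrite [X in (X * _)%E](_ : _ = 0%E) ?mul0e//.
  exact: (lebesgue_graph0 (@lebesgue_measure R) h).
have u00 : u 0 0 != 0 by have := col3_neq0 u0; rewrite u10 u20 eqxx !orbF.
have -> : P = ([set k / u 0 0] `*` setT) `*` setT.
  apply/seteqP; split => v; rewrite /P /= sum3E !mxE u20 u10 !mul0r !addr0 /=.
    by move=> <-; split => //; split => //; field.
  by move=> [[-> _] _]; field.
rewrite product_measure1E//; last exact: measurableX.
rewrite [X in (X * _)%E](_ : _ = 0%E) ?mul0e//.
rewrite [LHS]product_measure1E// [X in (X * _)%E](_ : _ = 0%E) ?mul0e//.
exact: lebesgue_measure_set1.
Qed.

Lemma integral_gauss1 (m d : R) : 0 < d ->
  (\int[@lebesgue_measure R]_x (expR (- (1 / 2) * ((x - m) ^+ 2 / d)))%:E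
   = (Num.sqrt (2 * pi * d))%:E)%E.
Proof.
move=> d0; pose s := Num.sqrt d.
have s0 : s != 0 by rewrite gt_eqF// sqrtr_gt0.
have E x : (expR (- (1 / 2) * ((x - m) ^+ 2 / d)))%:E
   = ((Num.sqrt (2 * pi * d))%:E * (normal_pdf m s x)%:E)%E.
  have -> : 2 * pi * d = s ^+ 2 * pi *+ 2.
    by rewrite sqr_sqrtr ?ltW// -mulr_natr; ring.
  rewrite normal_pdfE//= /normal_peak -EFinM mulVKf; last first.
    by rewrite gt_eqF// sqrtr_gt0 pmulrn_lgt0// mulr_gt0 ?pi_gt0 ?exprn_even_gt0.
  congr (expR _)%:E; rewrite sqr_sqrtr ?ltW// -mulr_natr.
  by field; rewrite gt_eqF.
under eq_integral do rewrite E.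
rewrite ge0_integralZl//.
- by rewrite integral_normal_pdf mule1.
- by apply/measurable_EFinP; exact: measurable_normal_pdf.
- by move=> x _; rewrite lee_fin normal_pdf_ge0.
Qed.

Lemma sigma_finite_lebesgue2 :
  sigma_finite setT (@lebesgue_measure R \x @lebesgue_measure R)%E.
Proof.
pose I (n : nat) : set (measurableTypeR R) := `[- n%:R, n%:R]%classic.
have mI n : measurable (I n) by exact: measurable_itv.
have Ioo n : (@lebesgue_measure R (I n) < +oo)%E.
  rewrite lebesgue_measure_itv /=.
  by case: ifP => _; rewrite ?ltry.
exists (fun n => I n `*` I n).
  apply/seteqP; split => // -[x y] _.
  exists (Num.bound (`|x| + `|y|)) => //.
  have := archi_boundP (addr_ge0 (normr_ge0 x) (normr_ge0 y)).
  rewrite /I /= !in_itv /= -!ler_norml => /ltW xy.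
  by split; apply: le_trans xy; rewrite ?lerDl ?lerDr.
move=> n; split; first exact: measurableX.
rewrite [X in (X < _)%E]product_measure1E// lte_mul_pinfty//.
rewrite ge0_fin_numE; first exact: Ioo.
exact: measure_ge0.
exact: Ioo.
Qed.

(** Integrating out the last coordinate.  Its centre may depend on the other
    coordinates: the inner integral does not see it. *)
Lemma integral_gauss_slice (d : measure_display) (T : measurableType d)
    (m : {measure set T -> \bar R}) (G h : T -> R) (s : R) :
  sigma_finite setT m -> 0 < s -> measurable_fun setT G -> (forall x, 0 <= G x) ->
  measurable_fun setT h ->
  (\int[m \x @lebesgue_measure R]_v
     (G v.1 * expR (- (1 / 2) * ((v.2 - h v.1) ^+ 2 / s)))%:E
   = (Num.sqrt (2 * pi * s))%:E * \int[m]_x (G x)%:E)%E.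
Proof.
move=> sm s0 mG G0 mh.
have sf : sfinite_measure m by exact: sfinite_measure_sigma_finite.
pose m' : {sigma_finite_measure set T -> \bar R} :=
  HB.pack_for {sigma_finite_measure set T -> \bar R} (Measure.sort m)
    (isSFinite.Build d T R m sf) (isSigmaFinite.Build d T R m sm).
rewrite (@fubini_tonelli1 _ _ T _ R m'); last 2 first.
- apply/measurable_EFinP; apply: measurable_funM.
    exact: (measurableT_comp mG measurable_fst).
  apply: measurableT_comp => //; apply: measurable_funM => //.
  apply: measurable_funM => //; apply: measurable_funX.
  apply: measurable_funB; first exact: measurable_snd.
  exact: (measurableT_comp mh measurable_fst).
- by move=> v; rewrite lee_fin mulr_ge0// expR_ge0.
rewrite -ge0_integralZl//; last 2 first.
- exact/measurable_EFinP.
- by move=> x _; rewrite lee_fin.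
apply: eq_integral => x _; rewrite /fubini_F /=.
under eq_integral do rewrite EFinM.
rewrite ge0_integralZl//.
- by rewrite integral_gauss1// muleC.
- apply/measurable_EFinP; apply: measurableT_comp => //; apply: measurable_funM => //.
  apply: measurable_funM => //; apply: measurable_funX.
  exact: measurable_funB.
- exact: G0.
Qed.

(** A nonnegative function with zero integral against an almost everywhere
    positive weight is itself almost everywhere zero. *)
Lemma ge0_integral_weight_eq0 (d : measure_display) (T : measurableType d)
    (m : {measure set T -> \bar R}) (f g : T -> R) :
  measurable_fun setT f -> measurable_fun setT g -> (forall x, 0 <= f x) ->
  (forall x, 0 <= g x) ->
  m [set x | g x = 0] = 0%E ->
  (\int[m]_x (f x * g x)%:E = 0 -> \int[m]_x (f x)%:E = 0)%E.
Proof.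
move=> mf mg f0 g0 mg0 fg0.
have ae_fg : ae_eq m setT (EFin \o (fun x => f x * g x)) (cst 0%E).
  apply/ae_eq_integral_abs => //.
    by apply/measurable_EFinP; exact: measurable_funM.
  rewrite -[RHS]fg0; apply: eq_integral => x _ /=.
  by rewrite ger0_norm// mulr_ge0.
have ae_g : {ae m, forall x, g x != 0}.
  exists [set x | g x = 0]; split => //.
    rewrite (_ : [set _ | _] = g @^-1` [set 0])//.
    by rewrite -[X in measurable X]setTI; exact: mg.
  by move=> x /= /negP; rewrite negbK => /eqP.
transitivity (\int[m]_x (cst 0%E x))%E; last by rewrite integral0.
apply: ae_eq_integral => //; first exact/measurable_EFinP.
apply: filterS2 ae_fg ae_g => x /= + gx _ => /(_ I) -[] /eqP.
by rewrite mulf_eq0 (negbTE gx) orbF => /eqP ->.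
Qed.

End Lebesgue3.

(** * Real-valued integrable functions *)

Section RealIntegral.
Context (d : measure_display) (T : measurableType d) (R : realType)
  (m : {measure set T -> \bar R}).
Implicit Types f g : T -> R.

Local Notation L1 f := (m.-integrable [set: T] (fun x => (f x)%:E)).

Lemma L1_le f g : measurable_fun setT f -> (forall x, `|f x| <= g x) ->
  L1 g -> L1 f.
Proof.
move=> mf fg; apply: le_integrable => //; first exact/measurable_EFinP.
by move=> x _ /=; rewrite lee_fin (le_trans (fg x))// ler_norm.
Qed.

Lemma ge0_L1 f : measurable_fun setT f -> (forall x, 0 <= f x) ->
  (\int[m]_x (f x)%:E < +oo)%E -> L1 f.
Proof.
move=> mf f0 foo; apply/integrableP; split; first exact/measurable_EFinP.
by under eq_integral do rewrite /= ger0_norm//.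
Qed.

Lemma L1_D f g : L1 f -> L1 g -> L1 (fun x => f x + g x).
Proof. exact: integrableD. Qed.

Lemma L1_B f g : L1 f -> L1 g -> L1 (fun x => f x - g x).
Proof. exact: integrableB. Qed.

Lemma L1_Zl (k : R) f : L1 f -> L1 (fun x => k * f x).
Proof. exact: integrableZl. Qed.

Lemma L1_sum n (F : 'I_n -> T -> R) :
  (forall i, L1 (F i)) -> L1 (fun x => \sum_i F i x).
Proof.
move=> iF; have := @integrable_sum _ _ _ m setT measurableT _ (index_enum 'I_n) xpredT
  (fun i x => (F i x)%:E) (fun i _ => iF i).
by apply: eq_integrable => // x _; rewrite sumEFin.
Qed.

Lemma Rintegral_sum n (F : 'I_n -> T -> R) : (forall i, L1 (F i)) ->
  \int[m]_x (\sum_i F i x) = \sum_i \int[m]_x F i x.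
Proof.
elim: n F => [|n ih] F iF.
  rewrite big_ord0; under eq_Rintegral do rewrite big_ord0.
  by rewrite /Rintegral integral0.
rewrite big_ord_recl; under eq_Rintegral do rewrite big_ord_recl.
rewrite RintegralD ?ih//; first exact: (iF ord0).
by apply: (@L1_sum n (fun i => F (lift ord0 i))) => i; exact: iF.
Qed.

Lemma integral_EFin f : L1 f -> (\int[m]_x (f x)%:E = (\int[m]_x f x)%:E)%E.
Proof. by move=> iF; rewrite /Rintegral fineK// integrable_fin_num. Qed.

End RealIntegral.

(** * Gaussians with a given covariance *)

Section Gaussian.
Context (R : realType).
Local Notation borel3 :=
  (measurableTypeR R * measurableTypeR R * measurableTypeR R)%type.
Local Notation mu := (lebesgue3 R).
Local Notation L1 f := (mu.-integrable [set: vspace3 R] (fun x => (f x)%:E)).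
Implicit Types (U : 'cV[R]_3) (Q K : 'M[R]_3) (r : R).

Lemma measurable_quadratic3 (d : measure_display) (T : measurableType d)
    (x y z : T -> R) (a b c p q s : R) : measurable_fun setT x ->
  measurable_fun setT y -> measurable_fun setT z ->
  measurable_fun setT (fun v => a * x v ^+ 2 + b * y v ^+ 2 + c * z v ^+ 2
    + p * (x v * y v) + q * (x v * z v) + s * (y v * z v)).
Proof.
move=> mx my mz.
have mk k (g : T -> R) : measurable_fun setT g -> measurable_fun setT (fun v => k * g v).
  by move=> mg; exact: measurable_funM.
by do !apply: measurable_funD; apply: mk; try apply: measurable_funX;
  try apply: measurable_funM.
Qed.

Lemma measurable_cst_expR (d : measure_display) (T : measurableType d)
    (q : T -> R) (k l : R) : measurable_fun setT q ->
  measurable_fun setT (fun v => k * expR (l * q v)).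
Proof.
move=> mq; apply: measurable_funM => //; apply: measurableT_comp => //.
exact: measurable_funM.
Qed.

Lemma measurable_centered U i :
  measurable_fun [set: vspace3 R] (fun v : vspace3 R => (vec3 v - U) i 0).
Proof.
rewrite (_ : (fun _ => _) = (fun v => vec3 v i 0 + (- U) i 0)); last first.
  by apply/funext => v; rewrite mxE.
exact: measurable_funD (measurable_coord i) (measurable_cst _).
Qed.

Lemma measurable_qform K U :
  measurable_fun [set: vspace3 R] (fun v : vspace3 R => qform K (vec3 v - U)).
Proof.
have mw := measurable_centered U.
under eq_fun do rewrite qform3E.
exact: (measurable_quadratic3 _ _ _ _ _ _ (mw 0) (mw 1) (mw 2)).
Qed.

(** [ellipsoidal_gaussian nu f] is this function at the mass, the mean and the
    temperature tensor of [f]; the covariance is a parameter because the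
    Gaussians of three covariances are compared. *)
Definition gaussian r U Q : vspace3 R -> R := fun v =>
  r / Num.sqrt (\det ((2 * pi) *: Q))
  * expR (- (1 / 2) * qform (invmx Q) (vec3 v - U)).

Lemma measurable_gaussian r U Q : measurable_fun [set: vspace3 R] (gaussian r U Q).
Proof.
exact: measurable_cst_expR (measurable_qform (invmx Q) U).
Qed.

Lemma gaussian_ge0 r U Q v : 0 <= r -> 0 <= gaussian r U Q v.
Proof. by move=> r0; rewrite mulr_ge0 ?expR_ge0// divr_ge0 ?sqrtr_ge0. Qed.

Lemma det_2pi_gt0 Q : posdef Q -> 0 < \det ((2 * pi) *: Q).
Proof.
by move=> pQ; apply: posdef3_det_gt0; apply: posdefZ => //; rewrite mulr_gt0 ?pi_gt0.
Qed.

(** The density factors as a product of one-dimensional Gaussians [G1], then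
    one centred at a function [h1] of the first coordinate, then one centred at
    a function [h2] of the first two; the variances multiply to the
    determinant. *)
Lemma integral_gaussian r U Q : 0 <= r -> posdef Q ->
  (\int[mu]_v (gaussian r U Q v)%:E = r%:E)%E.
Proof.
move=> r0 pQ; have [[[d1 d2] d3] [a [b [c []]]]] := posdef3_inv_squares pQ.
move=> /= d10 d20 d30 detQ qE.
have dd0 := det_2pi_gt0 pQ.
have s0 : 0 < Num.sqrt (\det ((2 * pi) *: Q)) by rewrite sqrtr_gt0.
pose G1 (x : measurableTypeR R) : R :=
  expR (- (1 / 2) * ((x - U 0 0) ^+ 2 / d1)).
pose h1 (x : measurableTypeR R) : R := U 1 0 + a * (x - U 0 0).
pose G2 (x : measurableTypeR R * measurableTypeR R) : R :=
  G1 x.1 * expR (- (1 / 2) * ((x.2 - h1 x.1) ^+ 2 / d2)).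
pose h2 (x : measurableTypeR R * measurableTypeR R) : R :=
  U 2 0 + (b * (x.1 - U 0 0) + c * (x.2 - U 1 0)).
pose G3 (v : borel3) : R :=
  G2 v.1 * expR (- (1 / 2) * ((v.2 - h2 v.1) ^+ 2 / d3)).
have GE v : gaussian r U Q v = r / Num.sqrt (\det ((2 * pi) *: Q)) * G3 v.
  rewrite /gaussian /G3 /G2 /G1 -!expRD -!mulrDr qE.
  have e1 : (vec3 v - U) 0 0 = v.1.1 - U 0 0 by rewrite !mxE.
  have e2 : (vec3 v - U) 1 0 - a * (vec3 v - U) 0 0 = v.1.2 - h1 v.1.1.
    by rewrite !mxE /= /h1 opprD addrA.
  have e3 : (vec3 v - U) 2 0 - (b * (vec3 v - U) 0 0 + c * (vec3 v - U) 1 0)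
      = v.2 - h2 v.1.
    by rewrite !mxE /= /h2 [in RHS]opprD addrA.
  by rewrite e2 e3 e1.
have mf1 : measurable_fun [set: measurableTypeR R * measurableTypeR R]
    (fst : _ -> measurableTypeR R) by exact: measurable_fst.
have mf2 : measurable_fun [set: measurableTypeR R * measurableTypeR R]
    (snd : _ -> measurableTypeR R) by exact: measurable_snd.
have mG1 : measurable_fun [set: measurableTypeR R] G1.
  apply: measurableT_comp => //; apply: measurable_funM => //.
  apply: measurable_funM => //; apply: measurable_funX.
  exact: measurable_funB.
have mh1 : measurable_fun [set: measurableTypeR R] h1.
  apply: measurable_funD => //; apply: measurable_funM => //.
  exact: measurable_funB.
have mG2 : measurable_fun [set: measurableTypeR R * measurableTypeR R] G2.
  apply: measurable_funM; first exact: (measurableT_comp mG1).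
  apply: measurableT_comp => //; apply: measurable_funM => //.
  apply: measurable_funM => //; apply: measurable_funX.
  apply: measurable_funB => //; exact: (measurableT_comp mh1).
have mh2 : measurable_fun [set: measurableTypeR R * measurableTypeR R] h2.
  apply: measurable_funD => //; apply: measurable_funD;
    by apply: measurable_funM => //; exact: measurable_funB.
have mG3 : measurable_fun [set: borel3] G3.
  apply: measurable_funM; first exact: (measurableT_comp mG2 measurable_fst).
  apply: measurableT_comp => //; apply: measurable_funM => //.
  apply: measurable_funM => //; apply: measurable_funX.
  apply: measurable_funB => //; exact: (measurableT_comp mh2 measurable_fst).
have G1_ge0 x : 0 <= G1 x by exact: expR_ge0.
have G2_ge0 x : 0 <= G2 x by rewrite mulr_ge0// expR_ge0.
have G3_ge0 x : 0 <= G3 x by rewrite mulr_ge0// expR_ge0.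
under eq_integral do rewrite GE EFinM.
rewrite (@ge0_integral_lebesgue3 R
  (fun v => (r / Num.sqrt (\det ((2 * pi) *: Q)))%:E * (G3 v)%:E)%E); last 2 first.
- by apply: measurable_funeM; exact/measurable_EFinP.
- by move=> v; rewrite mule_ge0// lee_fin ?divr_ge0// ltW.
rewrite ge0_integralZl//; last 3 first.
- exact/measurable_EFinP.
- by move=> v _; rewrite lee_fin.
- by rewrite lee_fin divr_ge0// ltW.
rewrite [X in (_ * X)%E](_ : _ = (Num.sqrt (\det ((2 * pi) *: Q)))%:E).
  by rewrite -EFinM divfK// gt_eqF.
have I1 := integral_gauss1 (U 0 0) d10.
have I2 := integral_gauss_slice (sigma_finiteT (@lebesgue_measure R)) d20 mG1 G1_ge0 mh1.
have I3 := integral_gauss_slice (@sigma_finite_lebesgue2 R) d30 mG2 G2_ge0 mh2.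
apply: (etrans I3); rewrite [X in (_ * X)%E]I2 [X in (_ * (_ * X))%E]I1.
rewrite -!EFinM; congr EFin.
have pd_ge0 (x : R) : 0 < x -> 0 <= 2 * pi * x.
  by move=> x0; rewrite mulr_ge0 ?(ltW x0)// mulr_ge0 ?pi_ge0.
rewrite -sqrtrM ?pd_ge0// -sqrtrM ?pd_ge0//.
by rewrite detZ detQ; congr Num.sqrt; ring.
Qed.

Lemma L1_gaussian r U Q : 0 <= r -> posdef Q -> L1 (gaussian r U Q).
Proof.
move=> r0 pQ; apply: ge0_L1; first exact: measurable_gaussian.
- by move=> v; exact: gaussian_ge0.
- by rewrite integral_gaussian// ltry.
Qed.

Lemma Rintegral_gaussian r U Q : 0 <= r -> posdef Q ->
  \int[mu]_v gaussian r U Q v = r.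
Proof. by move=> r0 pQ; rewrite /Rintegral integral_gaussian. Qed.

End Gaussian.

Section GaussianEntropy.
Context (R : realType).
Local Notation mu := (lebesgue3 R).
Local Notation L1 f := (mu.-integrable [set: vspace3 R] (fun x => (f x)%:E)).
Context (r : R) (U : 'cV[R]_3) (Q : 'M[R]_3) (r0 : 0 < r) (pQ : posdef Q).

Local Notation q := (fun v : vspace3 R => qform (invmx Q) (vec3 v - U)).
Local Notation G := (gaussian r U Q).

Lemma qform_inv_ge0 v : 0 <= q v.
Proof.
have [d [a [b [c [d1 d2 d3 _ ->]]]]] := posdef3_inv_squares pQ.
by rewrite !addr_ge0 ?divr_ge0 ?sqr_ge0// ltW.
Qed.

Lemma gaussian_gt0 v : 0 < G v.
Proof.
by rewrite /gaussian mulr_gt0 ?expR_gt0// divr_gt0// sqrtr_gt0 det_2pi_gt0.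
Qed.

(** Normalised so that [u] enters the exponential only; [u = 1] is the
    Gaussian itself. *)
Lemma gaussian_rescale (u : R) v : 0 < u ->
  u ^+ 3 * gaussian r U (u ^+ 2 *: Q) v
  = r / Num.sqrt (\det ((2 * pi) *: Q)) * expR (- (1 / 2) * (q v / u ^+ 2)).
Proof.
move=> u0; have u20 : u ^+ 2 != 0 by rewrite expf_neq0// gt_eqF.
have -> : qform (invmx Q) (vec3 v - U) / u ^+ 2
    = qform (invmx (u ^+ 2 *: Q)) (vec3 v - U).
  rewrite invmxZ; last exact: posdef_unit (posdefZ (exprn_gt0 2 u0) pQ).
  by rewrite qformZ mulrC.
have -> : gaussian r U (u ^+ 2 *: Q) v
    = r / (u ^+ 3 * Num.sqrt (\det ((2 * pi) *: Q)))
      * expR (- (1 / 2) * qform (invmx (u ^+ 2 *: Q)) (vec3 v - U)).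
  rewrite /gaussian; congr (r / _ * _).
  rewrite scalerA [2 * pi * _]mulrC -[in LHS]scalerA detZ exprAC sqrtrM ?sqr_ge0//.
  by rewrite sqrtr_sqr ger0_norm// exprn_ge0// ltW.
have := sqrtr_gt0 (\det ((2 * pi) *: Q)); rewrite det_2pi_gt0// => s0.
by field; rewrite !gt_eqF.
Qed.

Lemma gaussian_scaleE v :
  G v = r / Num.sqrt (\det ((2 * pi) *: Q)) * expR (- (1 / 2) * q v).
Proof. by []. Qed.

(** [x e^(-x/2) <= (8/3) e^(-x/8)], because [3 x / 8 <= e^(3 x / 8)]; the
    right side is a Gaussian of covariance [4 Q], up to the factor [2 ^ 3] of
    its normalisation. *)
Lemma L1_gaussian_qform : L1 (fun v => G v * q v).
Proof.
have := @L1_Zl _ _ _ mu (8 / 3 * 2 ^+ 3) _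
  (L1_gaussian U (ltW r0) (posdefZ (exprn_gt0 2 (ltr0n R 2)) pQ)).
apply: L1_le.
  exact: measurable_funM (measurable_gaussian r U Q) (measurable_qform _ U).
move=> v /=; rewrite -[leRHS]mulrA gaussian_rescale// ger0_norm; last first.
  by rewrite mulr_ge0 ?qform_inv_ge0// ltW// gaussian_gt0.
rewrite gaussian_scaleE mulrCA -mulrA ler_wpM2l//.
  by rewrite divr_ge0 ?sqrtr_ge0// ltW.
set x := qform _ _.
have -> : - (1 / 2) * (x / 2 ^+ 2) = - (1 / 2) * x + 3 / 8 * x by field.
rewrite expRD mulrCA ler_pM2l ?expR_gt0//.
have := expR_ge1Dx (3 / 8 * x); lra.
Qed.

(** Rescaling the covariance by [u ^ 2] multiplies the exponential by
    [e^(- k q)] with [k = (u^-2 - 1) / 2], which is at least [1 - k q].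
    Integrating, [u^3 r >= r - k J] where [J] is the second moment, and this is
    the stated inequality multiplied by [(1 - u) / (2 u^2)].  The difference
    quotient stands for the derivative of the normalising constant, so that
    nothing is differentiated under the integral sign. *)
Lemma gaussian_qform_ge_aux (u : R) : 0 < u < 1 ->
  2 * r * (u ^+ 2 * (1 + u + u ^+ 2)) <= (1 + u) * \int[mu]_v (G v * q v).
Proof.
move=> /andP[u0 u1]; set J := \int[mu]_v _.
have iGq := L1_gaussian_qform.
have iG := L1_gaussian U (ltW r0) pQ.
have pQu := posdefZ (exprn_gt0 2 u0) pQ.
have iGu := L1_gaussian U (ltW r0) pQu.
pose k := (u ^- 2 - 1) / 2.
have : \int[mu]_v (G v - k * (G v * q v))
    <= \int[mu]_v (u ^+ 3 * gaussian r U (u ^+ 2 *: Q) v).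
  apply: le_Rintegral => //.
  - exact: (L1_B iG (L1_Zl k iGq)).
  - exact: L1_Zl.
  move=> v _; rewrite gaussian_rescale// gaussian_scaleE.
  set x := q v; set c := r / _.
  have -> : - (1 / 2) * (x / u ^+ 2) = - (1 / 2) * x - k * x.
    by rewrite /k; field; rewrite gt_eqF.
  rewrite expRD.
  have -> : c * expR (- (1 / 2) * x) - k * (c * expR (- (1 / 2) * x) * x)
     = c * (expR (- (1 / 2) * x) * (1 - k * x)) by ring.
  rewrite ler_wpM2l ?divr_ge0 ?sqrtr_ge0 ?(ltW r0)//.
  by rewrite ler_wpM2l ?expR_ge0// expR_ge1Dx.
rewrite (RintegralB _ iG (L1_Zl k iGq))// (RintegralZl _ _ iGq)//.
rewrite (RintegralZl _ _ iGu)// !Rintegral_gaussian ?(ltW r0)// -/J => h.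
have : 0 <= (u ^+ 2 * 2 / (1 - u)) * (u ^+ 3 * r - (r - k * J)).
  by rewrite mulr_ge0 ?subr_ge0// divr_ge0 ?subr_ge0 ?(ltW u1)// mulr_ge0// sqr_ge0.
move=> pos; rewrite -subr_ge0; move: pos; congr (_ <= _); rewrite /k; field.
by rewrite gt_eqF//= subr_eq0 gt_eqF.
Qed.

(** The limit [u -> 1] of the previous inequality. *)
Lemma gaussian_qform_ge : 3 * r <= \int[mu]_v (G v * q v).
Proof.
set J := \int[mu]_v _.
have J0 : 0 <= J.
  by apply: Rintegral_ge0 => v _; rewrite mulr_ge0 ?qform_inv_ge0// ltW// gaussian_gt0.
rewrite leNgt; apply/negP => J3.
(* The lower bound for [J / r] as a function of [u] has slope [15 / 2] at
   [u = 1], and stays above [3 - 9 (1 - u)] on [0, 1]; at this [u] the latter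
   is the midpoint of [J / r] and [3]. *)
pose u := 1 - (3 * r - J) / (18 * r).
have rn0 : r != 0 by rewrite gt_eqF.
have e0 : 0 < (3 * r - J) / (18 * r) by rewrite divr_gt0 ?subr_gt0// mulr_gt0.
have e1 : (3 * r - J) / (18 * r) <= 1 / 6.
  by rewrite ler_pdivrMr ?mulr_gt0//; move: J0; clear; lra.
have u01 : 0 < u < 1.
  rewrite /u gtrBl e0 subr_gt0 andbT (le_lt_trans e1)//.
  by rewrite ltr_pdivrMr// mul1r ltr1n.
have := gaussian_qform_ge_aux u01; rewrite -/J.
have JE : J = r * (3 - 18 * (1 - u)) by rewrite /u; field.
clearbody u; rewrite JE.
have -> : 2 * r * (u ^+ 2 * (1 + u + u ^+ 2)) = r * (2 * (u ^+ 2 * (1 + u + u ^+ 2))).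
  by ring.
rewrite [leRHS]mulrCA ler_pM2l//.
case/andP: u01 => u0 u1.
have : 0 < (1 - u) * (9 * (1 + u) + (6 + 3 * u - 4 * u ^+ 2 - 2 * u ^+ 3)).
  rewrite mulr_gt0 ?subr_gt0//.
  have : u ^+ 2 <= 1 by rewrite expr_le1 ?ltW.
  have : u ^+ 3 <= 1 by rewrite expr_le1 ?ltW.
  lra.
lra.
Qed.

Definition gaussian_log_peak : R := ln r - 1 / 2 * ln (\det ((2 * pi) *: Q)).

Lemma ln_gaussian v : ln (G v) = gaussian_log_peak - 1 / 2 * q v.
Proof.
have d0 := det_2pi_gt0 pQ; have s0 : 0 < Num.sqrt (\det ((2 * pi) *: Q)).
  by rewrite sqrtr_gt0.
rewrite gaussian_scaleE lnM ?posrE ?expR_gt0 ?divr_gt0//.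
rewrite ln_div ?posrE// expRK /gaussian_log_peak mulNr.
have -> : ln (\det ((2 * pi) *: Q)) = 2 * ln (Num.sqrt (\det ((2 * pi) *: Q))).
  by rewrite -{1}(sqr_sqrtr (ltW d0)) lnXn// [RHS]mulr_natl.
by field.
Qed.

Lemma L1_gaussian_entropy : L1 (fun v => G v * ln (G v)).
Proof.
have := L1_B (L1_Zl gaussian_log_peak (L1_gaussian U (ltW r0) pQ))
  (L1_Zl (1 / 2) L1_gaussian_qform).
apply: eq_integrable => // v _; congr EFin; rewrite ln_gaussian; ring.
Qed.

Lemma gaussian_entropy_le :
  \int[mu]_v (G v * ln (G v)) <= r * gaussian_log_peak - 3 / 2 * r.
Proof.
have iG := L1_gaussian U (ltW r0) pQ; have iGq := L1_gaussian_qform.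
rewrite (_ : \int[mu]_v _ =
    \int[mu]_v (gaussian_log_peak * G v - 1 / 2 * (G v * q v))).
  rewrite (RintegralB _ (L1_Zl gaussian_log_peak iG) (L1_Zl (1 / 2) iGq))//.
  rewrite (RintegralZl _ _ iG)// (RintegralZl _ _ iGq)// Rintegral_gaussian ?(ltW r0)//.
  have := gaussian_qform_ge; lra.
by apply: eq_Rintegral => v _; rewrite ln_gaussian; ring.
Qed.

End GaussianEntropy.

(** * Moments of a velocity distribution *)

Section Moments.
Context (R : realType).
Local Notation mu := (lebesgue3 R).
Local Notation L1 f := (mu.-integrable [set: vspace3 R] (fun x => (f x)%:E)).
Context (f : vspace3 R -> R) (hf : velocity_distribution f).

Local Notation U := (bulk_velocity f).
Local Notation rho := (density f).
Local Notation Theta := (stress_tensor f).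

Lemma sqnorm3_qform (w : 'cV[R]_3) : sqnorm3 w = qform 1%:M w.
Proof. by rewrite qform_id. Qed.

Lemma L1_energy : L1 (fun v => (1 + sqnorm3 (vec3 v)) * f v).
Proof.
have m2 : measurable_fun [set: vspace3 R] (fun v : vspace3 R => 1 + sqnorm3 (vec3 v)).
  have mq : measurable_fun [set: vspace3 R] (fun v : vspace3 R => sqnorm3 (vec3 v)).
    have := measurable_qform 1%:M (0 : 'cV[R]_3).
    by congr (measurable_fun _); apply/funext => v; rewrite subr0 sqnorm3_qform.
  have mc : measurable_fun [set: vspace3 R] (fun => 1 : R) by exact: measurable_cst.
  exact: measurable_funD mc mq.
apply: ge0_L1.
- exact: measurable_funM m2 (vd_measurable hf).
- move=> v; rewrite mulr_ge0 ?(vd_ge0 hf)// addr_ge0//.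
  by apply: sumr_ge0 => i _; exact: sqr_ge0.
- exact: vd_moments.
Qed.

Lemma L1_moment (h : vspace3 R -> R) (C : R) :
  measurable_fun [set: vspace3 R] h ->
  (forall v, `|h v| <= C * (1 + sqnorm3 (vec3 v))) -> L1 (fun v => f v * h v).
Proof.
move=> mh hC; have := L1_Zl C L1_energy; apply: L1_le.
  exact: measurable_funM (vd_measurable hf) mh.
move=> v /=; rewrite normrM ger0_norm ?(vd_ge0 hf)// mulrC mulrA.
by rewrite ler_wpM2r ?(vd_ge0 hf).
Qed.

Lemma sqr_le_sqnorm3 (w : 'cV[R]_3) i : w i 0 ^+ 2 <= sqnorm3 w.
Proof.
rewrite /sqnorm3 (bigD1 i)//= lerDl.
by apply: sumr_ge0 => j _; exact: sqr_ge0.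
Qed.

Lemma L1_density : L1 f.
Proof.
have : L1 (fun v => f v * 1).
  apply: (@L1_moment (fun => 1) 1); first exact: measurable_cst.
  move=> v; rewrite normr1 mul1r lerDl.
  by apply: sumr_ge0 => j _; exact: sqr_ge0.
by apply: eq_integrable => // v _; rewrite mulr1.
Qed.

Lemma density_gt0 : 0 < rho.
Proof.
by have := vd_mass hf; rewrite (integral_EFin L1_density) lte_fin.
Qed.

Lemma L1_second_moment (A : 'cV[R]_3) i j :
  L1 (fun v => f v * ((vec3 v - A) i 0 * (vec3 v - A) j 0)).
Proof.
(* The constant comes from [2 |x y| <= x^2 + y^2] and
   [(x - a)^2 <= 2 x^2 + 2 a^2]. *)
apply: (@L1_moment _ (2 + A i 0 ^+ 2 + A j 0 ^+ 2)).
  exact: measurable_funM (measurable_centered A i) (measurable_centered A j).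
move=> v; have := sqr_le_sqnorm3 (vec3 v) i; have := sqr_le_sqnorm3 (vec3 v) j.
rewrite !mxE; set S := sqnorm3 _.
move: (nth _ _ i) (nth _ _ j) (A i 0) (A j 0) => x y a b yS xS.
have S0 : 0 <= S by apply: le_trans xS; exact: sqr_ge0.
have := sqr_ge0 (x + a); have := sqr_ge0 (y + b).
have := sqr_ge0 ((x - a) + (y - b)); have := sqr_ge0 ((x - a) - (y - b)).
have := mulr_ge0 (sqr_ge0 a) S0; have := mulr_ge0 (sqr_ge0 b) S0.
rewrite ler_norml; nra.
Qed.

Lemma qform_sum n (K : 'M[R]_n) (w : 'cV[R]_n) :
  qform K w = \sum_i \sum_j K i j * (w i 0 * w j 0).
Proof.
rewrite /qform -mulmxA mxE; apply: eq_bigr => i _.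
rewrite !mxE big_distrr; apply: eq_bigr => j _ /=; ring.
Qed.

Lemma L1_qform (K : 'M[R]_3) (A : 'cV[R]_3) :
  L1 (fun v => f v * qform K (vec3 v - A)).
Proof.
have : L1 (fun v => \sum_i \sum_j
    K i j * (f v * ((vec3 v - A) i 0 * (vec3 v - A) j 0))).
  by apply: L1_sum => i; apply: L1_sum => j; apply: L1_Zl; exact: L1_second_moment.
apply: eq_integrable => // v _; congr EFin; rewrite qform_sum big_distrr.
apply: eq_bigr => i _ /=; rewrite big_distrr; apply: eq_bigr => j _ /=; ring.
Qed.

Lemma Rintegral_second_moment i j :
  \int[mu]_v (f v * ((vec3 v - U) i 0 * (vec3 v - U) j 0)) = rho * Theta i j.
Proof.
rewrite mxE mulVKf ?gt_eqF ?density_gt0//.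
apply: eq_Rintegral => v _; congr (_ * _).
by rewrite [RHS]mxE big_ord1; congr (_ * _); rewrite [RHS]mxE.
Qed.

Lemma stress_tensor_sym : Theta^T = Theta.
Proof.
apply/matrixP => i j; rewrite mxE.
apply: (mulfI (lt0r_neq0 density_gt0)).
rewrite -!Rintegral_second_moment; apply: eq_Rintegral => v _.
by rewrite [in LHS](mulrC (_ j 0)).
Qed.

Lemma Rintegral_qform (K : 'M[R]_3) :
  \int[mu]_v (f v * qform K (vec3 v - U)) = rho * \tr (K *m Theta).
Proof.
pose F i j (v : vspace3 R) := K i j * (f v * ((vec3 v - U) i 0 * (vec3 v - U) j 0)).
have iF i j : L1 (F i j) by apply: L1_Zl; exact: L1_second_moment.
transitivity (\int[mu]_v (\sum_i \sum_j F i j v)).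
  apply: eq_Rintegral => v _; rewrite qform_sum big_distrr.
  apply: eq_bigr => i _ /=; rewrite big_distrr.
  by apply: eq_bigr => j _; rewrite /= mulrCA.
rewrite Rintegral_sum; last by move=> i; apply: L1_sum => j; exact: iF.
rewrite /mxtrace big_distrr; apply: eq_bigr => i _ /=.
rewrite Rintegral_sum//.
rewrite mxE big_distrr; apply: eq_bigr => j _ /=.
rewrite RintegralZl//; last exact: L1_second_moment.
by rewrite Rintegral_second_moment mulrCA -[in LHS]stress_tensor_sym [in LHS]mxE.
Qed.

Lemma trace_stress_tensor : \tr Theta = 3 * temperature f.
Proof.
rewrite /temperature.
under eq_Rintegral do rewrite sqnorm3_qform.
by rewrite Rintegral_qform mul1mx; field; rewrite gt_eqF ?density_gt0.
Qed.

(** [rho u^T Theta u] is the integral of [f] against the square of the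
    component of [v - U] along [u].  If it vanished, [f] would vanish outside
    the plane through [U] orthogonal to [u], hence almost everywhere. *)
Lemma posdef_stress_tensor : posdef Theta.
Proof.
split; first exact: stress_tensor_sym.
move=> u u0; pose K := u *m u^T.
have KE w : qform K w = (\sum_i u i 0 * w i 0) ^+ 2.
  rewrite /qform /K mulmxA -mulmxA mxE big_ord1 expr2; congr (_ * _); rewrite mxE;
    by apply: eq_bigr => i _; rewrite mxE// mulrC.
have E : rho * qform Theta u = \int[mu]_v (f v * qform K (vec3 v - U)).
  rewrite Rintegral_qform /K -mulmxA mxtrace_mulC.
  by rewrite /mxtrace big_ord1.
rewrite -(pmulr_rgt0 _ density_gt0) E lt_neqAle eq_sym.
have K0 v : 0 <= qform K (vec3 v - U) by rewrite KE sqr_ge0.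
rewrite Rintegral_ge0 ?andbT; last first.
  by move=> v _; rewrite mulr_ge0 ?(vd_ge0 hf).
apply/eqP => I0.
have plane0 : mu [set v | qform K (vec3 v - U) = 0] = 0%E.
  rewrite -[RHS](@lebesgue3_plane0 R u (\sum_i u i 0 * U i 0) u0).
  congr (mu _); apply/seteqP.
  have sumE v : \sum_i u i 0 * (vec3 v - U) i 0
      = \sum_i u i 0 * vec3 v i 0 - \sum_i u i 0 * U i 0.
    rewrite -sumrB; apply: eq_bigr => i _.
    by rewrite mxE mulrDr [(- U) i 0]mxE mulrN.
  split => v /=; rewrite KE sumE => h.
    by apply/eqP; rewrite -subr_eq0 -sqrf_eq0 h.
  by rewrite h subrr expr0n.
have fK0 : (\int[mu]_v (f v * qform K (vec3 v - U))%:E = 0)%E.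
  by rewrite (integral_EFin (L1_qform K U)) I0.
have := ge0_integral_weight_eq0 (vd_measurable hf) (measurable_qform K U) (vd_ge0 hf)
  K0 plane0 fK0.
by move=> f_0; have := vd_mass hf; rewrite f_0 ltxx.
Qed.

End Moments.

(** * Entropy *)

Section ExtendedLog.
Context (d : measure_display) (T : measurableType d) (R : realType)
  (m : {measure set T -> \bar R}).
Local Notation L1 f := (m.-integrable [set: T] (fun x => (f x)%:E)).

Lemma measurable_lne (f : T -> R) : measurable_fun setT f ->
  measurable_fun setT (fun x => lne (f x)%:E).
Proof.
move=> mf; apply: measurable_fun_ifT => //.
- exact: measurable_fun_ler.
- by apply/measurable_EFinP; exact: measurableT_comp.
Qed.

Lemma measurable_relaxation (A : R) (f g : T -> R) :
  measurable_fun setT g -> measurable_fun setT f ->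
  measurable_fun setT (fun x => (A * (g x - f x))%:E * lne (f x)%:E)%E.
Proof.
move=> mg mf; apply: emeasurable_funM; last exact: measurable_lne.
apply/measurable_EFinP; apply: measurable_funM => //; exact: measurable_funB.
Qed.

(** Only the upper bound is integrable: [F] may take the value [-oo] on a set
    of positive measure. *)
Lemma le_integral_integrable (F : T -> \bar R) (h : T -> R) :
  measurable_fun setT F -> L1 h -> (forall x, F x <= (h x)%:E)%E ->
  (\int[m]_x F x <= \int[m]_x (h x)%:E)%E.
Proof.
move=> mF ih Fh; have mh := measurable_int _ ih.
rewrite integralE [leRHS]integralE leeB//.
- apply: ge0_le_integral => //.
  + exact: measurable_funepos.
  + exact: measurable_funepos.
  + by move=> x _; apply: (@funepos_le _ _ setT) => //; rewrite inE.
- apply: ge0_le_integral => //.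
  + exact: measurable_funeneg.
  + exact: measurable_funeneg.
  + by move=> x _; apply: (@funeneg_le _ _ setT) => //; rewrite inE.
Qed.

End ExtendedLog.

Section Pointwise.
Context (R : realType).

(** Convexity of [x ln x]: its graph lies above the tangent at [y]. *)
Lemma xlnx_ge (x y : R) : 0 <= x -> 0 < y -> x * ln y + x - y <= x * ln x.
Proof.
rewrite le_eqVlt => /predU1P[<-|x0] y0.
  by rewrite !mul0r !add0r oppr_le0 ltW.
have := ln_le_sub1 (divr_gt0 y0 x0).
rewrite ln_div ?posrE// -(ler_pM2l x0).
have -> : x * (y / x - 1) = y - x by field; rewrite gt_eqF.
lra.
Qed.

Lemma mul_lne (x : R) : 0 <= x -> (x%:E * lne x%:E = (x * ln x)%:E)%E.
Proof.
rewrite le_eqVlt => /predU1P[<-|x0]; first by rewrite mul0e mul0r.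
by rewrite lne_EFin.
Qed.

Lemma mul_lne_div (x y : R) : 0 <= x -> 0 < y ->
  (x%:E * lne (x / y)%:E = (x * ln x - x * ln y)%:E)%E.
Proof.
rewrite le_eqVlt => /predU1P[<-|x0] y0; first by rewrite mul0e !mul0r subrr.
by rewrite lne_EFin ?divr_gt0// ln_div ?posrE// -EFinM mulrBr.
Qed.

(** For [x > 0] this is the tangent inequality at [x], evaluated at [y]; at
    [x = 0] the left side is [-oo]. *)
Lemma relaxation_lne_le (A x y : R) : 0 < A -> 0 <= x -> 0 < y ->
  ((A * (y - x))%:E * lne x%:E <= (A * (y * ln y - x * ln x + (x - y)))%:E)%E.
Proof.
move=> A0; rewrite le_eqVlt => /predU1P[<-|x0] y0.
  by rewrite subr0 le0_lneNy// mulrNy gtr0_sg ?mulr_gt0// mul1e leNye.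
rewrite lne_EFin// -EFinM lee_fin -mulrA ler_pM2l//.
have := xlnx_ge (ltW y0) x0; lra.
Qed.

End Pointwise.

Section EntropyProduction.
Context (R : realType).
Local Notation mu := (lebesgue3 R).
Local Notation L1 f := (mu.-integrable [set: vspace3 R] (fun x => (f x)%:E)).
Context (f : vspace3 R -> R) (hf : velocity_distribution f).

Local Notation U := (bulk_velocity f).
Local Notation rho := (density f).
Local Notation Theta := (stress_tensor f).
Local Notation S := (\int[mu]_v (f v * ln (f v))).
Local Notation kappa Q := (gaussian_log_peak rho Q).
Local Notation G Q := (gaussian rho U Q).

Lemma L1_entropy : L1 (fun v => f v * ln (f v)).
Proof.
have := vd_entropy hf; apply: eq_integrable => // v _.
by rewrite mul_lne ?(vd_ge0 hf).
Qed.

Lemma f_ln_gaussianE Q v : posdef Q -> f v * ln (G Q v)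
  = kappa Q * f v - 1 / 2 * (f v * qform (invmx Q) (vec3 v - U)).
Proof. by move=> pQ; rewrite (ln_gaussian U (density_gt0 hf) pQ); ring. Qed.

Lemma L1_f_ln_gaussian Q : posdef Q -> L1 (fun v => f v * ln (G Q v)).
Proof.
move=> pQ; have := L1_B (L1_Zl (kappa Q) (L1_density hf))
  (L1_Zl (1 / 2) (L1_qform hf (invmx Q) U)).
by apply: eq_integrable => // v _; rewrite f_ln_gaussianE.
Qed.

Lemma Rintegral_f_ln_gaussian Q : posdef Q ->
  \int[mu]_v (f v * ln (G Q v))
  = rho * kappa Q - 1 / 2 * (rho * \tr (invmx Q *m Theta)).
Proof.
move=> pQ; under eq_Rintegral do rewrite (f_ln_gaussianE _ pQ).
have i1 := L1_density hf; have i2 := L1_qform hf (invmx Q) U.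
rewrite (RintegralB _ (L1_Zl (kappa Q) i1) (L1_Zl (1 / 2) i2))//.
rewrite (RintegralZl _ _ i1)// (RintegralZl _ _ i2)// Rintegral_qform//.
by rewrite mulrC.
Qed.

(** Gibbs' inequality against the Gaussian that has the mass, the mean and the
    stress tensor of [f]: the quadratic part of its logarithm integrates
    against [f] to [3 rho], the trace of the identity. *)
Lemma entropy_ge : rho * kappa Theta - 3 / 2 * rho <= S.
Proof.
have pT := posdef_stress_tensor hf; have r0 := density_gt0 hf.
have -> : rho * kappa Theta - 3 / 2 * rho =
    \int[mu]_v (f v * ln (G Theta v) + (f v - G Theta v)).
  rewrite (RintegralD _ (L1_f_ln_gaussian pT)
    (L1_B (L1_density hf) (L1_gaussian U (ltW r0) pT)))//.
  rewrite (RintegralB _ (L1_density hf) (L1_gaussian U (ltW r0) pT))//.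
  rewrite Rintegral_gaussian ?(ltW r0)// subrr addr0 Rintegral_f_ln_gaussian//.
  by rewrite mulVmx ?posdef_unit// mxtrace1; field.
apply: le_Rintegral => //.
- exact: L1_D (L1_f_ln_gaussian pT)
    (L1_B (L1_density hf) (L1_gaussian U (ltW r0) pT)).
- exact: L1_entropy.
move=> v _; rewrite addrA; apply: xlnx_ge; first exact: vd_ge0.
exact: gaussian_gt0.
Qed.

Lemma temperature_gt0 : 0 < temperature f.
Proof.
have [[q0 q1 q2] _] := posdef3_minors (posdef_stress_tensor hf).
have := trace_stress_tensor hf; rewrite /mxtrace sum3E; lra.
Qed.

Lemma relative_entropyE Q : posdef Q ->
  relative_entropy f (G Q)
  = (S - (rho * kappa Q - 1 / 2 * (rho * \tr (invmx Q *m Theta))))%:E.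
Proof.
move=> pQ; rewrite /relative_entropy.
transitivity (\int[mu]_v (f v * ln (f v) - f v * ln (G Q v))%:E)%E.
  apply: eq_integral => v _; apply: mul_lne_div; first exact: vd_ge0.
  exact: (gaussian_gt0 U (density_gt0 hf) pQ).
rewrite (integral_EFin (L1_B L1_entropy (L1_f_ln_gaussian pQ))); congr EFin.
by rewrite (RintegralB _ L1_entropy (L1_f_ln_gaussian pQ))// Rintegral_f_ln_gaussian.
Qed.

(** The Gaussian shares the mass of [f], so that the linear term of the
    pointwise bound integrates to zero. *)
Lemma entropy_production_ge (A : R) Q : 0 < A -> posdef Q ->
  ((A * (S - (rho * kappa Q - 3 / 2 * rho)))%:E
   <= - \int[mu]_v ((A * (G Q v - f v))%:E * lne (f v)%:E))%E.
Proof.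
move=> A0 pQ; have r0 := density_gt0 hf.
have iG := L1_gaussian U (ltW r0) pQ; have iGG := L1_gaussian_entropy U r0 pQ.
have iS := L1_entropy; have i1 := L1_density hf.
pose h v := A * (G Q v * ln (G Q v) - f v * ln (f v) + (f v - G Q v)).
have ih : L1 h := L1_Zl A (L1_D (L1_B iGG iS) (L1_B i1 iG)).
have mF := measurable_relaxation A (measurable_gaussian rho U Q) (vd_measurable hf).
have Fh v : ((A * (G Q v - f v))%:E * lne (f v)%:E <= (h v)%:E)%E.
  exact: relaxation_lne_le A0 (vd_ge0 hf v) (gaussian_gt0 U r0 pQ v).
rewrite leeNr -EFinN; apply: le_trans (le_integral_integrable mF ih Fh) _.
rewrite (integral_EFin ih) lee_fin /h.
rewrite (RintegralZl _ _ (L1_D (L1_B iGG iS) (L1_B i1 iG)))//.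
rewrite (RintegralD _ (L1_B iGG iS) (L1_B i1 iG))//.
rewrite (RintegralB _ iGG iS)// (RintegralB _ i1 iG)//.
rewrite Rintegral_gaussian ?(ltW r0)// subrr addr0 -mulrN ler_pM2l// opprB.
by rewrite lerD2r; exact: gaussian_entropy_le.
Qed.

End EntropyProduction.

Theorem theorem2p1 (R : realType) (alpha beta nu : R)
    (alpha_ge0 : 0 <= alpha) (beta_ge0 : 0 <= beta)
    (nu_gt : - (1 / 2) < nu) (nu_lt : nu < 1)
    (f : vspace3 R -> R) (hf : velocity_distribution f) :
  ((Num.min (1 + 2 * nu) (1 - nu) * collision_frequency alpha beta nu f)%:E
     * relative_entropy f (local_maxwellian f)
   <= entropy_production alpha beta nu f)%E.
Proof.
have r0 := density_gt0 hf; have T0 := temperature_gt0 hf.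
have pTheta := posdef_stress_tensor hf.
set A := collision_frequency alpha beta nu f; set c := Num.min _ _.
have A0 : 0 < A.
  by rewrite divr_gt0 ?subr_gt0// mulr_gt0 ?powR_gt0.
have [pB] := ln_det_tensor_ge pTheta (trace_stress_tensor hf) nu_gt nu_lt.
rewrite -/c -/(temperature_tensor nu f) /= => ln_det_B.
have B0 : temperature_tensor 0 f = (temperature f)%:M.
  by rewrite /temperature_tensor subr0 mul1r scale0r addr0.
have pB0 := posdef_scalar 3 T0.
have -> : relative_entropy f (local_maxwellian f)
    = relative_entropy f (gaussian (density f) (bulk_velocity f) (temperature f)%:M).
  by rewrite -B0.
rewrite (relative_entropyE hf pB0) -EFinM.
apply: le_trans (entropy_production_ge hf A0 pB); rewrite lee_fin.
have -> : \tr (invmx (temperature f)%:M *m stress_tensor f) = 3.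
  rewrite invmx_scalar mul_scalar_mx mxtraceZ trace_stress_tensor//.
  by field; rewrite gt_eqF.
rewrite (mulrC c) -[leLHS]mulrA ler_pM2l//.
have := entropy_ge hf.
have ln_det_2pi (Q : 'M[R]_3) : posdef Q ->
    ln (\det ((2 * pi) *: Q)) = ln ((2 * pi) ^+ 3) + ln (\det Q).
  move=> /posdef3_det_gt0 d0; rewrite detZ.
  have p0 : 0 < (2 * pi) ^+ 3 :> R by rewrite exprn_gt0// mulr_gt0// pi_gt0.
  by apply: lnM; rewrite posrE.
rewrite /gaussian_log_peak !ln_det_2pi//.
have c1 : c <= 1 by rewrite /c ge_min; lra.
move: ln_det_B c1; move: (\int[_]_v _) (ln (density f)) (ln (_ ^+ 3)) => S L p.
move: (ln _) (ln (\det (stress_tensor f))) (ln _) => a b t ln_det_B c1 S_ge.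
(* The deficit is the minimality of the Gaussian of covariance [Theta], with
   weight [1 - c], plus the determinant inequality. *)
rewrite -subr_ge0.
have : 0 <= (1 - c) * (S - (density f * (L - 1 / 2 * (p + b)) - 3 / 2 * density f))
    + 1 / 2 * (density f * (a - (c * t + (1 - c) * b))).
  apply: addr_ge0; first by rewrite mulr_ge0// subr_ge0.
  apply: mulr_ge0; first by rewrite divr_ge0.
  by apply: mulr_ge0; [exact: ltW|rewrite subr_ge0].
by congr (_ <= _); field.
Qed.
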